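(* Let $m,n$ be positive integers and $s,k$ even positive integers. There exists a ${}^2\mathrm{H}(m,n;s,k)$ if and only if $ms=nk$, $2\le s\le n$, $2\le k\le m$, and $s,k$ are not both equal to $2$.
   Context: For positive integers $m,n,s,k,\lambda,t$ with $t$ dividing $\frac{2nk}{\lambda}$, let $v=\frac{2nk}{\lambda}+t$ and $J$ the subgroup of $\mathbb{Z}_v$ of order $t$. A ${}^\lambda\mathrm{H}_t(m,n;s,k)$ is an $m\times n$ partially filled array with entries in $\mathbb{Z}_v$ such that: (a) each row has exactly $s$ and each column exactly $k$ filled cells; (b) the multiset $\{\pm x: x$ an entry of a filled cell$\}$ contains each element of $\mathbb{Z}_v\setminus J$ exactly $\lambda$ times and no element of $J$; (c) every row and every column sums to $0$ in $\mathbb{Z}_v$. The subscript $t$ is omitted when $t=1$, so ${}^2\mathrm{H}(m,n;s,k)$ is over $\mathbb{Z}_{nk+1}$. *)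

(* Defs.v *)
From mathcomp Require Import all_boot all_order all_algebra.
Set Implicit Arguments. Unset Strict Implicit. Unset Printing Implicit Defensive.
Import GRing.Theory.
Local Open Scope ring_scope.

(* A partially filled m x n array with entries in 'Z_v is a function
   'I_m -> 'I_n -> option 'Z_v (None = empty cell). *)

Definition row_filled (m n v : nat) (A : 'I_m -> 'I_n -> option 'Z_v) (i : 'I_m) : nat :=
  #|[set j : 'I_n | A i j != None]|.
Definition col_filled (m n v : nat) (A : 'I_m -> 'I_n -> option 'Z_v) (j : 'I_n) : nat :=
  #|[set i : 'I_m | A i j != None]|.

(* Multiplicity of y in the multiset {+-x : x entry of a filled cell}. *)
Definition pm_mult (m n v : nat) (A : 'I_m -> 'I_n -> option 'Z_v) (y : 'Z_v) : nat :=
  (#|[set p : 'I_m * 'I_n | A p.1 p.2 == Some y]|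
   + #|[set p : 'I_m * 'I_n | A p.1 p.2 == Some (- y)]|)%N.

Definition cellv (v : nat) (c : option 'Z_v) : 'Z_v := if c is Some x then x else 0.

(* ^lambda H_t(m,n;s,k) with lambda = 2 and t = 1: over Z_v, v = n*k+1,
   J = {0}.  Note n*k+1 >= 2 whenever n,k > 0, so 'Z_(n*k+1) is really Z_v. *)
Definition is_2H (m n s k : nat) (A : 'I_m -> 'I_n -> option 'Z_(n * k + 1)) : Prop :=
  [/\ (forall i, row_filled A i = s),
      (forall j, col_filled A j = k),
      (forall y : 'Z_(n * k + 1), pm_mult A y = if y == 0 then 0%N else 2%N),
      (forall i, \sum_(j < n) cellv (A i j) = 0)
    & (forall j, \sum_(i < m) cellv (A i j) = 0)].
Arguments is_2H : clear implicits.

(* Main.v *)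
Require Import Defs.
From mathcomp Require Import all_boot all_order all_algebra.
From mathcomp Require Import zify ring.
Set Implicit Arguments. Unset Strict Implicit. Unset Printing Implicit Defensive.
Import GRing.Theory.

(* Necessity is counting: the filled cells counted by rows and by columns give
   ms = nk and s <= n, k <= m; and if s = k = 2, following an entry x through
   its row, its column and the next row places both x and -x in two cells
   each, beyond the allowed multiplicity 2.

   Sufficiency is proved for k >= 4 (the case k = 2 then follows by
   transposition) through three layers of general constructions:
   - cyclic arrays: a sequence f of length ms = kn, whose i-th block of s
     entries is written into row i cyclically around the n columns, gives a
     ^2H as soon as its s-blocks and its residue classes mod n sum to zero and
     its entries with their negatives cover Z_(nk+1) \ {0} twice;
   - pair expansion: writing each W q as the pair -W q, W q kills the block
     sums and doubles the multiset, so it suffices that W is a signed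
     permutation of 1, ..., nk/2 with vanishing residue-class sums;
   - block arrays: W is read off a K x D array with entries +-(lD + pi_l t + 1),
     and the residue condition becomes one on its column sums: all zero when
     n = 2D, all equal when n = D is odd.  Four explicit sign/permutation
     patterns, according to the parities of n and k/2, satisfy it. *)

Section CyclicReindexing.
Variables (R : Type) (idx : R) (op : Monoid.com_law idx).
Local Notation "\big_ ( i < n ) F" := (\big[op/idx]_(i < n) F)
  (at level 36, F at level 36, i, n at level 50).

Lemma big_ord_mul (a b : nat) (F : nat -> R) :
  \big_(p < a * b) F p = \big_(i < a) \big_(u < b) F (i * b + u).
Proof.
elim: a => [|a IH]; first by rewrite mul0n !big_ord0.
rewrite big_ord_recr /= -IH mulSn addnC big_split_ord /=.
by congr (op _ _); apply: eq_bigr => u _; rewrite addnC.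
Qed.

Definition cyc_off (n b j : nat) : nat := (j + n - b %% n) %% n.

Lemma cyc_offP (n b u j : nat) : u < n -> j < n ->
  ((b + u) %% n == j) = (u == cyc_off n b j).
Proof.
move=> ltun ltjn; rewrite /cyc_off.
have lebn : b %% n <= n by apply: ltnW; rewrite ltn_mod; lia.
have {1}-> : j = (b + (j + n - b %% n)) %% n.
  by rewrite -modnDml addnC subnK ?modnDr ?(modn_small ltjn) //; lia.
by rewrite (eqn_modDl b) (modn_small ltun).
Qed.

Lemma big_ord_if_eq (N x : nat) (G : nat -> R) :
  \big_(u < N) (if u == x :> nat then G u else idx) = if x < N then G x else idx.
Proof. by rewrite -big_mkcond big_ord1_eq. Qed.

Lemma big_cyc_window (n s b j : nat) (G : nat -> R) : s <= n -> j < n ->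
  (if cyc_off n b j < s then G (b + cyc_off n b j) else idx)
  = \big_(u < s) (if (b + u) %% n == j then G (b + u) else idx).
Proof.
move=> le_sn ltjn; rewrite -(big_ord_if_eq s _ (fun u => G (b + u))).
by apply: eq_bigr => u _; rewrite cyc_offP // (leq_trans (ltn_ord u)).
Qed.

Lemma big_cyc_row (n s b : nat) (G : nat -> R) : s <= n ->
  \big_(j < n) (if cyc_off n b j < s then G (b + cyc_off n b j) else idx)
  = \big_(u < s) G (b + u).
Proof.
move=> le_sn; under eq_bigr => j _ do rewrite big_cyc_window //.
rewrite exchange_big; apply: eq_bigr => u _.
have n_gt0 : 0 < n by move: (ltn_ord u); lia.
under eq_bigr do rewrite eq_sym.
by rewrite (big_ord_if_eq n _ (fun _ => G (b + u))) ltn_mod n_gt0.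
Qed.

Lemma big_residue (n k j : nat) (G : nat -> R) : j < n ->
  \big_(p < k * n) (if p %% n == j then G p else idx) = \big_(l < k) G (l * n + j).
Proof.
move=> ltjn; rewrite (big_ord_mul k n (fun p => if p %% n == j then G p else idx)).
apply: eq_bigr => l _.
under eq_bigr => u _ do rewrite modnMDl modn_small //.
by rewrite (big_ord_if_eq n j (fun u => G (l * n + u))) ltjn.
Qed.

Lemma big_cyc_col (m n s k j : nat) (G : nat -> R) :
  m * s = k * n -> s <= n -> j < n ->
  \big_(i < m) (if cyc_off n (i * s) j < s then G (i * s + cyc_off n (i * s) j) else idx)
  = \big_(l < k) G (l * n + j).
Proof.
move=> ms_kn le_sn ltjn; under eq_bigr => i _ do rewrite big_cyc_window //.
by rewrite -(big_ord_mul m s (fun p => if p %% n == j then G p else idx)) ms_kn big_residue.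
Qed.

End CyclicReindexing.

Local Open Scope ring_scope.

(* A ^2H(m,n;s,k) over Z_v for an arbitrary modulus v: the frozen [is_2H] is
   the case v = n * k + 1, and the general form is stable under transposition,
   which exchanges (m,s) with (n,k). *)
Definition is_H2 (v m n s k : nat) (A : 'I_m -> 'I_n -> option 'Z_v) : Prop :=
  [/\ (forall i, row_filled A i = s),
      (forall j, col_filled A j = k),
      (forall y : 'Z_v, pm_mult A y = if y == 0 then 0%N else 2%N),
      (forall i, \sum_(j < n) cellv (A i j) = 0)
    & (forall j, \sum_(i < m) cellv (A i j) = 0)].
Arguments is_H2 : clear implicits.

Lemma card_set_sum (T : finType) (P : pred T) : #|[set x | P x]| = (\sum_x P x)%N.
Proof. by rewrite -sum1_card big_mkcond; apply: eq_bigr => x _; rewrite inE; case: (P x). Qed.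

Section CyclicArray.
Variables (v m n s k : nat) (f : nat -> 'Z_v).
Hypotheses (le_sn : (s <= n)%N) (ms_kn : (m * s = k * n)%N).

Definition cyc_array (i : 'I_m) (j : 'I_n) : option 'Z_v :=
  if (cyc_off n (i * s) j < s)%N then Some (f (i * s + cyc_off n (i * s) j)%N) else None.

Lemma big_cyc_array_row (R : Type) (idx : R) (op : Monoid.com_law idx)
    (F : option 'Z_v -> R) (i : 'I_m) : F None = idx ->
  \big[op/idx]_(j < n) F (cyc_array i j) = \big[op/idx]_(u < s) F (Some (f (i * s + u)%N)).
Proof.
move=> F0; rewrite -(big_cyc_row op _ (fun p => F (Some (f p))) le_sn).
by apply: eq_bigr => j _; rewrite /cyc_array; case: ifP.
Qed.

Lemma big_cyc_array_col (R : Type) (idx : R) (op : Monoid.com_law idx)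
    (F : option 'Z_v -> R) (j : 'I_n) : F None = idx ->
  \big[op/idx]_(i < m) F (cyc_array i j) = \big[op/idx]_(l < k) F (Some (f (l * n + j)%N)).
Proof.
move=> F0; rewrite -(big_cyc_col op (fun p => F (Some (f p))) ms_kn le_sn (ltn_ord j)).
by apply: eq_bigr => i _; rewrite /cyc_array; case: ifP.
Qed.

Lemma cyc_array_count (y : 'Z_v) :
  #|[set p : 'I_m * 'I_n | cyc_array p.1 p.2 == Some y]| = (\sum_(p < m * s) (f p == y))%N.
Proof.
rewrite card_set_sum -(pair_bigA _ (fun i j => (cyc_array i j == Some y) : nat)) /=.
rewrite (big_ord_mul addn m s (fun p => (f p == y) : nat)); apply: eq_bigr => i _.
by rewrite (big_cyc_array_row addn (F := fun c => (c == Some y) : nat)).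
Qed.

Lemma cyc_array_H2 :
  (forall i, (i < m)%N -> \sum_(u < s) f (i * s + u)%N = 0) ->
  (forall j, (j < n)%N -> \sum_(l < k) f (l * n + j)%N = 0) ->
  (forall y, (\sum_(p < m * s) ((f p == y) + (f p == - y)))%N = if y == 0 then 0%N else 2%N) ->
  is_H2 v m n s k cyc_array.
Proof.
move=> rowsP colsP multP; split.
- move=> i; rewrite /row_filled card_set_sum.
  rewrite (big_cyc_array_row addn (F := fun c => (c != None) : nat)) //.
  by rewrite sum_nat_const card_ord muln1.
- move=> j; rewrite /col_filled card_set_sum.
  rewrite (big_cyc_array_col addn (F := fun c => (c != None) : nat)) //.
  by rewrite sum_nat_const card_ord muln1.
- by move=> y; rewrite /pm_mult !cyc_array_count -big_split multP.
- by move=> i; rewrite (big_cyc_array_row +%R (F := @cellv v)) // rowsP.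
- by move=> j; rewrite (big_cyc_array_col +%R (F := @cellv v)) // colsP.
Qed.

End CyclicArray.

Section PairExpansion.
Variables (v : nat) (W : nat -> 'Z_v).

Definition pair_seq (p : nat) : 'Z_v := if odd p then W p./2 else - W p./2.

Lemma pair_seq_shift (q x : nat) :
  pair_seq (q * 2 + x) = if odd x then W (q + x./2) else - W (q + x./2).
Proof. by rewrite /pair_seq oddD halfD muln2 odd_double doubleK. Qed.

(* A block of even length starting at an even position consists of pairs. *)
Lemma pair_seq_rows (s i : nat) : ~~ odd s -> \sum_(u < s) pair_seq (i * s + u) = 0.
Proof.
move=> even_s; rewrite -[s](even_halfK even_s) -muln2.
rewrite (big_ord_mul +%R _ 2 (fun u => pair_seq (i * (s./2 * 2) + u))).
apply: big1 => w _; rewrite !big_ord_recr big_ord0 /= add0r.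
have shift x : (i * (s./2 * 2) + (w * 2 + x) = (i * s./2 + w) * 2 + x)%N by ring.
by rewrite !shift !pair_seq_shift /= addn0 addNr.
Qed.

(* Each W q contributes both W q and -W q. *)
Lemma pair_seq_mult (N : nat) (y : 'Z_v) :
  (\sum_(p < N * 2) ((pair_seq p == y) + (pair_seq p == - y)))%N
  = (2 * \sum_(q < N) ((W q == y) + (W q == - y)))%N.
Proof.
rewrite (big_ord_mul addn N 2 (fun p => (pair_seq p == y) + (pair_seq p == - y))%N).
rewrite big_distrr /=; apply: eq_bigr => q _.
rewrite !big_ord_recr big_ord0 /= !pair_seq_shift /= !addn0.
by rewrite eqr_opp eqr_oppLR; case: (W q == y); case: (W q == - y).
Qed.

(* Columns for n = 2D: the residue class of j modulo 2D meets only the entries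
   (-1)^(j+1) W (l * D + j/2). *)
Lemma pair_seq_cols_even (n D K j : nat) : n = (D * 2)%N -> (j < n)%N ->
  (forall t, (t < D)%N -> \sum_(l < K) W (l * D + t) = 0) ->
  \sum_(l < K) pair_seq (l * n + j) = 0.
Proof.
move=> -> ltj colsW; under eq_bigr => l _ do rewrite mulnA pair_seq_shift.
have ltjD : (j./2 < D)%N by rewrite ltn_half_double -muln2.
by case: (odd j); rewrite ?sumrN colsW ?oppr0.
Qed.

(* Columns for odd n: rows 2l and 2l + 1 meet W (l * n + t) and W (l * n + t')
   with opposite signs, so equal column sums of W cancel. *)
Lemma pair_seq_cols_odd (n k K j : nat) (T : 'Z_v) : odd n -> k = (K * 2)%N -> (j < n)%N ->
  (forall t, (t < n)%N -> \sum_(l < K) W (l * n + t) = T) ->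
  \sum_(l < k) pair_seq (l * n + j) = 0.
Proof.
move=> odd_n -> ltjn colsW.
rewrite (big_ord_mul +%R K 2 (fun l => pair_seq (l * n + j))).
have row2 (l e : nat) : ((l * 2 + e) * n + j = (l * n) * 2 + (e * n + j))%N by ring.
under eq_bigr => l _ do rewrite !big_ord_recr big_ord0 /= add0r !row2 !pair_seq_shift.
rewrite big_split /= mul0n mul1n add0n oddD odd_n.
have ltj1 : (j./2 < n)%N by rewrite ltn_half_double -muln2; lia.
have ltj2 : ((n + j)./2 < n)%N by rewrite ltn_half_double -muln2; lia.
by case: (odd j); rewrite /= ?sumrN !colsW ?addNr ?addrN.
Qed.

End PairExpansion.

Definition sgn (v : nat) (b : bool) (x : nat) : 'Z_v := if b then x%:R else - x%:R.

Lemma count_succ_eq (N c : nat) : (\sum_(x < N) (x.+1 == c) = (0 < c <= N))%N.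
Proof.
case: c => [|c]; first by rewrite big1.
rewrite (eq_bigr (fun x : 'I_N => if x == c :> nat then 1 else 0)%N).
  by rewrite (big_ord_if_eq addn N c (fun _ => 1%N)); case: ltnP.
by move=> x _; rewrite eqSS; case: eqP.
Qed.

Lemma eqZp_nat (v x z : nat) : (1 < v)%N -> ((x%:R : 'Z_v) == z%:R) = (x == z %[mod v]).
Proof. by move=> v_gt1; rewrite -val_eqE /= !val_Zp_nat. Qed.

Section SignedPermutation.
Variables (N v : nat).
Hypotheses (N_gt0 : (0 < N)%N) (v_eq : v = (N * 2 + 1)%N).

Lemma succ_pm_count (y : 'Z_v) :
  (\sum_(x < N) ((x.+1%:R == y) + (x.+1%:R == - y)) = (y != 0%R))%N.
Proof.
have v_gt1 : (1 < v)%N by lia.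
have [a lt_av ->] : exists2 a, (a < v)%N & y = a%:R.
  exists (nat_of_ord y); last by rewrite natr_Zp.
  by have := ltn_ord y; move: (nat_of_ord y) => a; rewrite Zp_cast.
have -> : - (a%:R : 'Z_v) = (v - a)%:R by rewrite natrB ?pchar_Zp ?sub0r // ltnW.
have succ_mod (x : 'I_N) c : (x.+1 == c %[mod v]) = (x.+1 == c %% v)%N.
  by rewrite modn_small //; have := ltn_ord x; lia.
have nz : (a%:R != 0 :> 'Z_v) = (0 < a)%N by rewrite -val_eqE /= val_Zp_nat // modn_small // lt0n.
under eq_bigr => x _ do rewrite !eqZp_nat // !succ_mod.
rewrite big_split /= !count_succ_eq nz (modn_small lt_av).
case: (posnP a) => [->|a_gt0]; first by rewrite subn0 modnn.
rewrite modn_small; lia.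
Qed.

Lemma signed_perm_mult (W : nat -> 'Z_v) (b : 'I_N -> bool) (sigma : 'I_N -> 'I_N) :
  injective sigma -> (forall q : 'I_N, W q = sgn v (b q) (sigma q).+1) ->
  forall y, (\sum_(q < N) ((W q == y) + (W q == - y)) = (y != 0%R))%N.
Proof.
move=> sigma_inj Wq y; rewrite -succ_pm_count [RHS](reindex_inj sigma_inj) /=.
apply: eq_bigr => q _; rewrite Wq /sgn; case: (b q) => //.
by rewrite eqr_opp eqr_oppLR addnC.
Qed.

End SignedPermutation.

(* A block array with K rows and D columns: row l, column t holds
   +-(l * D + pi_l t + 1) with each pi_l a permutation of [0, D), so that
   every magnitude 1, ..., K * D occurs exactly once.  Read row by row it is
   the sequence block_seq. *)
Section BlockArray.
Variables (v D : nat) (eps : nat -> nat -> bool) (pi : nat -> nat -> nat).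
Hypothesis D_gt0 : (0 < D)%N.
Hypothesis pi_lt : forall l t, (t < D)%N -> (pi l t < D)%N.
Hypothesis pi_inj : forall l t t', (t < D)%N -> (t' < D)%N -> pi l t = pi l t' -> t = t'.

Definition block_val (l t : nat) : 'Z_v := sgn v (eps l t) (l * D + pi l t).+1.

Definition block_seq (q : nat) : 'Z_v := block_val (q %/ D) (q %% D).

Lemma block_seqE (l t : nat) : (t < D)%N -> block_seq (l * D + t) = block_val l t.
Proof. by move=> ltD; rewrite /block_seq divnMDl // divn_small // addn0 modnMDl modn_small. Qed.

(* The magnitude of block_seq q, minus one. *)
Definition block_rank (q : nat) : nat := q %/ D * D + pi (q %/ D) (q %% D).

Lemma block_rank_lt (K q : nat) : (q < K * D)%N -> (block_rank q < K * D)%N.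
Proof.
move=> ltq; have ltl : (q %/ D < K)%N by rewrite ltn_divLR.
have := pi_lt (q %/ D) (ltn_pmod q D_gt0).
have : (q %/ D * D + D <= K * D)%N by rewrite -mulSnr leq_mul2r ltl orbT.
by rewrite /block_rank; lia.
Qed.

Lemma block_rank_inj (q q' : nat) : block_rank q = block_rank q' -> q = q'.
Proof.
rewrite /block_rank => eq_rank.
have ltpi (r : nat) : (pi (r %/ D) (r %% D) < D)%N by apply: pi_lt; apply: ltn_pmod.
have eq_row : (q %/ D = q' %/ D)%N.
  have := congr1 (divn^~ D) eq_rank; rewrite /= !divnMDl //.
  by rewrite (divn_small (ltpi q)) (divn_small (ltpi q')) !addn0.
rewrite eq_row in eq_rank; have /pi_inj eq_col : pi (q' %/ D) (q %% D) = pi (q' %/ D) (q' %% D).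
  by apply/eqP; rewrite -(eqn_add2l (q' %/ D * D)) eq_rank.
by rewrite (divn_eq q D) (divn_eq q' D) eq_row eq_col ?ltn_pmod.
Qed.

Lemma block_seq_mult (K : nat) : (0 < K)%N -> v = (K * D * 2 + 1)%N ->
  forall y : 'Z_v, (\sum_(q < K * D) ((block_seq q == y) + (block_seq q == - y)) = (y != 0%R))%N.
Proof.
move=> K_gt0 v_eq; pose sigma (q : 'I_(K * D)) := Ordinal (block_rank_lt (ltn_ord q)).
apply: (@signed_perm_mult _ _ _ v_eq _ (fun q : 'I_(K * D) => eps (q %/ D) (q %% D)) sigma).
- by rewrite muln_gt0 K_gt0.
- by move=> q q' /(congr1 val) /block_rank_inj; apply: val_inj.
- by [].
Qed.

End BlockArray.

(* Row patterns for the block arrays.  In four consecutive rows with signs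
   + - - + the entries of each column cancel. *)
Definition quad_sign (l : nat) : bool := ((l %% 4 == 0) || (l %% 4 == 3))%N.

Lemma quad_sum (v g D x : nat) :
  \sum_(l < g * 4) sgn v (quad_sign l) (l * D + x).+1 = 0.
Proof.
rewrite (big_ord_mul +%R g 4 (fun l => sgn v (quad_sign l) (l * D + x).+1)).
apply: big1 => i _; rewrite !big_ord_recr big_ord0 /= /quad_sign /sgn !modnMDl /=.
by ring.
Qed.

(* With alternating signs + - each pair of rows contributes -D to a column. *)
Lemma alt_sum (v g D x : nat) :
  \sum_(l < g * 2) sgn v (~~ odd l) (l * D + x).+1 = - (g * D)%:R.
Proof.
rewrite (big_ord_mul +%R g 2 (fun l => sgn v (~~ odd l) (l * D + x).+1)).
transitivity (\sum_(i < g) - (D%:R : 'Z_v)).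
  apply: eq_bigr => i _; rewrite !big_ord_recr big_ord0 /= /sgn !oddD !oddM /= andbF /=.
  by ring.
by rewrite sumrN sumr_const card_ord natrM mulr_natl.
Qed.

Definition closing_sign (e : nat) : bool := ((e != 0) && (e != 2))%N.

Lemma closing_sum (v a D t : nat) : (t < D)%N ->
  \sum_(e < 6) sgn v (closing_sign e) (a + e * D + (if e == 5 then (D.-1 - t)%N else t)).+1
  = (a * 2 + D * 12 + 1)%:R.
Proof.
move=> ltt; rewrite !big_ord_recr big_ord0 /= /sgn /closing_sign /=.
have [r ->] : exists r, D = (t + r).+1 by exists (D.-1 - t)%N; lia.
by rewrite /= addKn; ring.
Qed.

(* Three permutations of [0, 2h+1) with constant sum: the identity, the
   rotation by h and the folding t |-> 2h - 2t (mod 2h+1). *)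
Definition rot_perm (h t : nat) : nat := if (t <= h)%N then (t + h)%N else (t - h - 1)%N.
Definition fold_perm (h t : nat) : nat :=
  if (t <= h)%N then (h * 2 - t * 2)%N else (h * 4 + 1 - t * 2)%N.

Lemma rot_fold_sum (h t : nat) : (t < h * 2 + 1)%N -> (t + rot_perm h t + fold_perm h t = h * 3)%N.
Proof. by rewrite /rot_perm /fold_perm; case: (leqP t h); lia. Qed.

Lemma rot_perm_lt (h t : nat) : (t < h * 2 + 1)%N -> (rot_perm h t < h * 2 + 1)%N.
Proof. by rewrite /rot_perm; case: (leqP t h); lia. Qed.

Lemma fold_perm_lt (h t : nat) : (t < h * 2 + 1)%N -> (fold_perm h t < h * 2 + 1)%N.
Proof. by rewrite /fold_perm; case: (leqP t h); lia. Qed.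

Lemma rot_perm_inj (h t t' : nat) : (t < h * 2 + 1)%N -> (t' < h * 2 + 1)%N ->
  rot_perm h t = rot_perm h t' -> t = t'.
Proof. by rewrite /rot_perm; case: (leqP t h); case: (leqP t' h); lia. Qed.

Lemma fold_perm_inj (h t t' : nat) : (t < h * 2 + 1)%N -> (t' < h * 2 + 1)%N ->
  fold_perm h t = fold_perm h t' -> t = t'.
Proof. by rewrite /fold_perm; case: (leqP t h); case: (leqP t' h); lia. Qed.

Section BlockConstruction.
Variables (m n s k : nat).
Hypotheses (s_gt0 : (0 < s)%N) (le_sn : (s <= n)%N) (even_s : ~~ odd s).
Hypotheses (k_gt0 : (0 < k)%N) (ms_nk : (m * s = n * k)%N).

(* Rows: pair expansion; multiset: signed permutation; columns: assumed. *)
Lemma block_H2 (D K : nat) (eps : nat -> nat -> bool) (pi : nat -> nat -> nat) :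
  (0 < D)%N -> (K * D * 2 = n * k)%N ->
  (forall l t, (t < D)%N -> (pi l t < D)%N) ->
  (forall l t t', (t < D)%N -> (t' < D)%N -> pi l t = pi l t' -> t = t') ->
  (forall j, (j < n)%N ->
     \sum_(l < k) pair_seq (block_seq (n * k + 1) D eps pi) (l * n + j) = 0) ->
  exists A, is_H2 (n * k + 1) m n s k A.
Proof.
move=> D_gt0 KD_nk pi_lt pi_inj colsP.
have : (0 < K * D * 2)%N by rewrite KD_nk muln_gt0 k_gt0 andbT; lia.
rewrite !muln_gt0 => /andP[/andP[K_gt0 _] _].
exists (@cyc_array _ m n s (pair_seq (block_seq (n * k + 1) D eps pi))).
apply: cyc_array_H2 => //; rewrite ?(mulnC k) //.
- by move=> i _; apply: pair_seq_rows.
- move=> y; have -> : (m * s = K * D * 2)%N by rewrite ms_nk KD_nk.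
  rewrite pair_seq_mult.
  by rewrite (block_seq_mult eps D_gt0 pi_lt pi_inj K_gt0) ?KD_nk //; case: (y == 0).
Qed.

Lemma block_H2_even (D : nat) (eps : nat -> nat -> bool) (pi : nat -> nat -> nat) :
  n = (D * 2)%N ->
  (forall l t, (t < D)%N -> (pi l t < D)%N) ->
  (forall l t t', (t < D)%N -> (t' < D)%N -> pi l t = pi l t' -> t = t') ->
  (forall t, (t < D)%N -> \sum_(l < k) block_val (n * k + 1) D eps pi l t = 0) ->
  exists A, is_H2 (n * k + 1) m n s k A.
Proof.
move=> n_eq pi_lt pi_inj colsP; have D_gt0 : (0 < D)%N by lia.
apply: (block_H2 (K := k) (eps := eps) (pi := pi) D_gt0) => //; first by rewrite n_eq; ring.
move=> j ltjn; apply: (pair_seq_cols_even n_eq ltjn).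
by move=> t ltt; rewrite -[RHS](colsP t ltt); apply: eq_bigr => l _; rewrite block_seqE.
Qed.

Lemma block_H2_odd (K : nat) (eps : nat -> nat -> bool) (pi : nat -> nat -> nat) (T : 'Z_(n * k + 1)) :
  odd n -> k = (K * 2)%N ->
  (forall l t, (t < n)%N -> (pi l t < n)%N) ->
  (forall l t t', (t < n)%N -> (t' < n)%N -> pi l t = pi l t' -> t = t') ->
  (forall t, (t < n)%N -> \sum_(l < K) block_val (n * k + 1) n eps pi l t = T) ->
  exists A, is_H2 (n * k + 1) m n s k A.
Proof.
move=> odd_n k_eq pi_lt pi_inj colsP; have n_gt0 : (0 < n)%N by lia.
apply: (block_H2 (K := K) (eps := eps) (pi := pi) n_gt0) => //; first by rewrite k_eq; ring.
move=> j ltjn; apply: (pair_seq_cols_odd odd_n k_eq ltjn (T := T)).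
by move=> t ltt; rewrite -[RHS](colsP t ltt); apply: eq_bigr => l _; rewrite block_seqE.
Qed.


Lemma H2_even_quad (D g : nat) : n = (D * 2)%N -> k = (g * 4)%N ->
  exists A, is_H2 (n * k + 1) m n s k A.
Proof.
move=> n_eq k_eq.
apply: (block_H2_even (eps := fun l _ => quad_sign l) (pi := fun _ t => t) n_eq) => //.
by move=> t _; rewrite k_eq; apply: quad_sum.
Qed.

(* n = 2D and k = 4g + 6: 4g rows as above, then the closing band, whose
   column sums 2 (4g) D + 12 D + 1 = n k + 1 vanish in Z_(nk+1). *)
Lemma H2_even_closing (D g : nat) : n = (D * 2)%N -> k = (g * 4 + 6)%N ->
  exists A, is_H2 (n * k + 1) m n s k A.
Proof.
move=> n_eq k_eq.
pose eps (l : nat) (_ : nat) := if (l < g * 4)%N then quad_sign l else closing_sign (l - g * 4).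
pose pi (l t : nat) := if l == (g * 4 + 5)%N then (D.-1 - t)%N else t.
apply: (block_H2_even (eps := eps) (pi := pi) n_eq) => [l t|l t t'|t ltt].
- by rewrite /pi; case: ifP; lia.
- by rewrite /pi; case: ifP; lia.
have quad_band (i : 'I_(g * 4)) :
    block_val (n * k + 1) D eps pi i t = sgn (n * k + 1) (quad_sign i) (i * D + t).+1.
  by rewrite /block_val /eps /pi (ltn_ord i) ifN_eq //; have := ltn_ord i; lia.
have closing_band (e : 'I_6) : block_val (n * k + 1) D eps pi (g * 4 + e) t
    = sgn (n * k + 1) (closing_sign e) (g * 4 * D + e * D + (if e == 5 :> nat then (D.-1 - t)%N else t)).+1.
  by rewrite /block_val /eps /pi ltnNge leq_addr addKn eqn_add2l mulnDl.
transitivity ((n * k + 1)%:R : 'Z_(n * k + 1)); last by apply: pchar_Zp; lia.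
subst k; rewrite big_split_ord /=.
under eq_bigr do rewrite quad_band.
under [X in _ + X]eq_bigr do rewrite closing_band.
by rewrite quad_sum add0r closing_sum // n_eq; congr _%:R; ring.
Qed.

Lemma H2_odd_alt (g : nat) : odd n -> k = (g * 4)%N ->
  exists A, is_H2 (n * k + 1) m n s k A.
Proof.
move=> odd_n k_eq.
apply: (block_H2_odd (K := g * 2) (eps := fun l _ => ~~ odd l) (pi := fun _ t => t)
          (T := - (g * n)%:R) odd_n) => //; first by rewrite k_eq -mulnA.
by move=> t _; apply: alt_sum.
Qed.

Lemma H2_odd_three (h g : nat) : n = (h * 2 + 1)%N -> k = ((3 + g * 2) * 2)%N ->
  exists A, is_H2 (n * k + 1) m n s k A.
Proof.
move=> n_eq k_eq.
pose eps (l : nat) (_ : nat) := (l < 3)%N || ~~ odd (l - 3).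
pose pi (l t : nat) := if l == 1%N then rot_perm h t else if l == 2%N then fold_perm h t else t.
have odd_n : odd n by rewrite n_eq oddD oddM andbF.
apply: (block_H2_odd (K := 3 + g * 2) (eps := eps) (pi := pi)
          (T := (n * 3 + h * 3 + 3)%:R - (g * n)%:R) odd_n k_eq) => [l t|l t t'|t ltt].
- rewrite /pi n_eq.
  by case: ifP => _; [apply: rot_perm_lt | case: ifP => _ //; apply: fold_perm_lt].
- rewrite /pi n_eq.
  by case: ifP => _; [apply: rot_perm_inj | case: ifP => _ //; apply: fold_perm_inj].
have band (i : nat) : block_val (n * k + 1) n eps pi (3 + i) t
                      = sgn (n * k + 1) (~~ odd i) (i * n + (n * 3 + t)).+1.
  rewrite /block_val /eps /pi addKn ltnNge leq_addr -[(3 + i)%N]/(i.+3) /=.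
  by congr sgn; ring.
rewrite big_split_ord /=; under [X in _ + X]eq_bigr => i _ do rewrite band.
rewrite alt_sum !big_ord_recr big_ord0 /= add0r /block_val /sgn /pi /=.
congr (_ + _); rewrite -!natrD; congr _%:R.
by have := @rot_fold_sum h t; rewrite -n_eq => /(_ ltt); lia.
Qed.

Lemma H2_exists_k_ge4 : ~~ odd k -> (4 <= k)%N -> exists A, is_H2 (n * k + 1) m n s k A.
Proof.
move=> even_k ge4k.
have [r k_eq] : exists r, k = (r * 2)%N by exists k./2; rewrite muln2 even_halfK.
have [h n_eq] : exists h, n = (h * 2 + odd n)%N by exists n./2; rewrite muln2 addnC odd_double_half.
have [g r_eq] : exists g, r = (g * 2 + odd r)%N by exists r./2; rewrite muln2 addnC odd_double_half.
move: n_eq r_eq; case: (odd n); case: (odd r) => /= n_eq r_eq.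
- by apply: (H2_odd_three (h := h) (g := g.-1)); lia.
- by apply: (H2_odd_alt (g := g)); [rewrite n_eq oddD oddM andbF | lia].
- by apply: (H2_even_closing (D := h) (g := g.-1)); lia.
- by apply: (H2_even_quad (D := h) (g := g)); lia.
Qed.

End BlockConstruction.

Lemma H2_transpose (v m n s k : nat) (B : 'I_n -> 'I_m -> option 'Z_v) :
  is_H2 v n m k s B -> is_H2 v m n s k (fun i j => B j i).
Proof.
case=> rowsB colsB multB rsumB csumB; split => // y.
rewrite -(multB y) /pm_mult !card_set_sum.
rewrite -!(pair_bigA _ (fun i j => (B j i == _) : nat)) -!(pair_bigA _ (fun i j => (B i j == _) : nat)).
by rewrite [X in (X + _)%N]exchange_big [X in (_ + X)%N]exchange_big.
Qed.

(* Counting the filled cells by rows and by columns. *)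
Lemma H2_necessary (v m n s k : nat) (A : 'I_m -> 'I_n -> option 'Z_v) :
  (0 < m)%N -> (0 < n)%N -> is_H2 v m n s k A -> [/\ (m * s = n * k)%N, (s <= n)%N & (k <= m)%N].
Proof.
move=> m_gt0 n_gt0 [rowsA colsA _ _ _]; split.
- have <- : (\sum_(i < m) row_filled A i = m * s)%N.
    by rewrite (eq_bigr (fun=> s)) // sum_nat_const card_ord.
  have <- : (\sum_(j < n) col_filled A j = n * k)%N.
    by rewrite (eq_bigr (fun=> k)) // sum_nat_const card_ord.
  rewrite /row_filled /col_filled.
  under eq_bigr do rewrite card_set_sum.
  under [RHS]eq_bigr do rewrite card_set_sum.
  by rewrite exchange_big.
- by rewrite -(rowsA (Ordinal m_gt0)) -[leqRHS]card_ord max_card.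
- by rewrite -(colsA (Ordinal n_gt0)) -[leqRHS]card_ord max_card.
Qed.

Lemma two_cell_line (v n : nat) (F : 'I_n -> option 'Z_v) (j1 : 'I_n) (x : 'Z_v) :
  #|[set j | F j != None]| = 2%N -> \sum_(j < n) cellv (F j) = 0 -> F j1 = Some x ->
  exists2 j2, j2 != j1 & F j2 = Some (- x).
Proof.
set S := [set j | F j != None] => cardS sumF Fj1.
have j1S : j1 \in S by rewrite inE Fj1.
have /cards1P[j2 S_j1] : #|S :\ j1| == 1%N by move: cardS; rewrite (cardsD1 j1) j1S add1n => -[->].
have : j2 \in S :\ j1 by rewrite S_j1 set11.
rewrite !inE => /andP[j2_j1]; case Fj2: (F j2) => [w|] // _.
exists j2 => //; rewrite Fj2; congr Some; apply/eqP; rewrite -addr_eq0 addrC.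
move: sumF; rewrite (bigD1 j1) // (bigD1 j2) //= Fj1 Fj2 /= big1 ?addr0 => [/eqP //|j /andP[j_j1 j_j2]].
have : j \notin S by rewrite -(setD1K j1S) S_j1 !inE negb_or j_j1.
by rewrite inE negbK => /eqP ->.
Qed.

Lemma two_le_card_cells (v m n : nat) (A : 'I_m -> 'I_n -> option 'Z_v) (x : 'Z_v) (p q : 'I_m * 'I_n) :
  p.1 != q.1 -> A p.1 p.2 = Some x -> A q.1 q.2 = Some x ->
  (2 <= #|[set r : 'I_m * 'I_n | A r.1 r.2 == Some x]|)%N.
Proof.
move=> p1q1 Ap Aq; have pq : p != q by apply: contraNneq p1q1 => ->.
apply: (@leq_trans #|[set p; q]|); first by rewrite cards2 pq.
by apply/subset_leq_card/subsetP => r; rewrite !inE => /orP[] /eqP->; rewrite ?Ap ?Aq.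
Qed.

(* There is no ^2H(m,n;2,2): following x from a row into its column and back
   into another row places both x and -x in at least two cells each. *)
Lemma not_H2_2_2 (v m n : nat) (A : 'I_m -> 'I_n -> option 'Z_v) :
  (0 < m)%N -> ~ is_H2 v m n 2 2 A.
Proof.
move=> m_gt0 [rowsA colsA multA rsumA csumA]; pose i0 := Ordinal m_gt0.
have /set0Pn[j1] : [set j | A i0 j != None] != set0 by rewrite -cards_eq0 [#|_|]rowsA.
rewrite inE; case Ai0j1: (A i0 j1) => [x|] // _.
have [j2 _ Ai0j2] := two_cell_line (rowsA i0) (rsumA i0) Ai0j1.
have [i1 i1_i0 Ai1j1] := two_cell_line (colsA j1) (csumA j1) Ai0j1.
have [j3 _ Ai1j3] := two_cell_line (rowsA i1) (rsumA i1) Ai1j1; rewrite opprK in Ai1j3.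
have := two_le_card_cells (p := (i0, j1)) (q := (i1, j3)) _ Ai0j1 Ai1j3.
have := two_le_card_cells (p := (i0, j2)) (q := (i1, j1)) _ Ai0j2 Ai1j1.
rewrite eq_sym i1_i0 => /(_ isT) card_nx /(_ isT) card_x.
have : (2 + 2 <= pm_mult A x)%N by apply: leq_add.
by rewrite multA; case: (x == 0).
Qed.

(* Necessity by H2_necessary and not_H2_2_2; sufficiency by the block
   constructions for k >= 4, and by transposing them when k = 2 (then s >= 4). *)
Theorem theorem4 (m n s k : nat) :
  (0 < m)%N -> (0 < n)%N -> (0 < s)%N -> (0 < k)%N -> ~~ odd s -> ~~ odd k ->
  (exists A : 'I_m -> 'I_n -> option 'Z_(n * k + 1), is_2H m n s k A)
  <-> [/\ (m * s = n * k)%N, (2 <= s <= n)%N, (2 <= k <= m)%N & ~ (s = 2 /\ k = 2)%N].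
Proof.
move=> m_gt0 n_gt0 s_gt0 k_gt0 even_s even_k.
have even_ge2 (r : nat) : (0 < r)%N -> ~~ odd r -> (2 <= r)%N by case: r => [|[]].
split.
- case=> A HA; have [ms_nk le_sn le_km] := H2_necessary m_gt0 n_gt0 HA.
  split; rewrite ?even_ge2 //.
  by case=> s2 k2; move: A HA; rewrite s2 k2 => A; apply: not_H2_2_2.
- case=> ms_nk /andP[_ le_sn] /andP[_ le_km] not22.
  have [ge4k | lt4k] := leqP 4 k; first exact: H2_exists_k_ge4.
  have k2 : k = 2%N by move: even_k (even_ge2 k k_gt0 even_k) lt4k; case: (k) => [|[|[|[]]]].
  have ge4s : (4 <= s)%N.
    move: even_s (even_ge2 s s_gt0 even_s) not22; rewrite k2.
    by case: (s) => [|[|[|[]]]] // _ _ [].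
  have [B HB] := H2_exists_k_ge4 k_gt0 le_km even_k s_gt0 (esym ms_nk) even_s ge4s.
  by move: B HB; rewrite ms_nk => B /H2_transpose HB; exists (fun i j => B j i).
Qed.
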